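(* Let $n,m\geq 1$ and let $(S_1,\dots,S_{n+m})$ be a random vector of real scores which is exchangeable (its distribution is invariant under any permutation of coordinates) and has almost surely no ties. Define the conformal $p$-values $$p_i=\frac{1}{n+1}\Big(1+\sum_{j=1}^n \mathbf{1}\{S_j\geq S_{n+i}\}\Big),\quad i\in\{1,\dots,m\}.$$ Then $(p_1,\dots,p_m)$ has joint distribution $P_{n,m}$; in particular this joint distribution does not depend on the specific distribution of the scores.
   Context: For a fixed $U=(U_1,\dots,U_n)\in[0,1]^n$ with order statistics $U_{(1)}\leq\dots\leq U_{(n)}$ and conventions $U_{(0)}=0$, $U_{(n+1)}=1$, $P^U$ is the distribution on $\{\ell/(n+1):\ell\in\{1,\dots,n+1\}\}$ with $P^U(\{\ell/(n+1)\})=U_{(\ell)}-U_{(\ell-1)}$. $P_{n,m}$ is the distribution on $[0,1]^m$ of $(q_1,\dots,q_m)$ generated as follows: $U_1,\dots,U_n$ i.i.d. $\mathrm{Unif}[0,1]$, and conditionally on $U=(U_1,\dots,U_n)$, $q_1,\dots,q_m$ i.i.d. with distribution $P^U$. *)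

(* Defs.v *)
From HB Require Import structures.
From mathcomp Require Import all_boot all_order all_algebra all_fingroup.
From mathcomp Require Import all_classical all_reals all_analysis.
Set Implicit Arguments. Unset Strict Implicit. Unset Printing Implicit Defensive.
Import Order.TTheory GRing.Theory Num.Theory.
Local Open Scope classical_set_scope.
Local Open Scope ring_scope.

Definition rectangles (R : realType) (k : nat) : set (set ('I_k -> R)) :=
  [set A | exists B : 'I_k -> set R, (forall j, measurable (B j)) /\
           A = [set x | forall j, B j (x j)]].

Definition borel_prod (R : realType) (k : nat) : set (set ('I_k -> R)) :=
  smallest (sigma_algebra setT) (@rectangles R k).

Definition exchangeable (d : measure_display) (T : measurableType d)
  (R : realType) (P : probability T R) (k : nat) (S : 'I_k -> T -> R) : Prop :=
  forall (s : 'S_k) (A : set ('I_k -> R)), borel_prod A ->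
    P [set t | A (fun j => S (s j) t)] = P [set t | A (fun j => S j t)].

Definition no_ties_as (d : measure_display) (T : measurableType d)
  (R : realType) (P : probability T R) (k : nat) (S : 'I_k -> T -> R) : Prop :=
  {ae P, forall t, injective (fun j => S j t)}.

(* Conformal p-value p_{i+1} (i : 'I_m, 0-based): score S_{n+i+1} is
   S (rshift n i), calibration scores S_{j+1} are S (lshift m j). *)
Definition conformal_pvalue (R : realType) (n m : nat)
  (S : 'I_(n + m) -> R) (i : 'I_m) : R :=
  (1 + #|[set j : 'I_n | S (rshift n i) <= S (lshift m j)]|)%:R / (n.+1)%:R.

(* Order statistics with conventions U_(0) = 0, U_(n+1) = 1:
   ostat u k = U_(k) for u = (U_1,...,U_n) listed as a sequence. *)
Definition ostat (R : realType) (u : seq R) (k : nat) : R :=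
  nth 0 (0 :: rcons (sort <=%R u) 1) k.

(* E[F(U_1,...,U_n)] for U_1,...,U_n i.i.d. Unif[0,1], F >= 0, written as
   the iterated Lebesgue integral over [0,1]^n (Tonelli). *)
Fixpoint iid_unif_expect (R : realType) (n : nat) (F : seq R -> R) : \bar R :=
  match n with
  | 0 => (F [::])%:E
  | n'.+1 => (\int[@lebesgue_measure R]_(x in `[0%R, 1%R])
                 iid_unif_expect n' (fun s => F (x :: s)))%E
  end.

(* P_{n,m}({(q_1,...,q_m)}) for q_i = (l i).+1 / (n+1), l i : 'I_(n+1):
   E_U [ prod_i P^U({q_i}) ] = E_U [ prod_i (U_(l_i+1) - U_(l_i)) ]. *)
Definition Pnm_pmf (R : realType) (n m : nat) (l : 'I_m -> 'I_n.+1) : \bar R :=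
  @iid_unif_expect R n (fun u => \prod_(i < m) (ostat u (l i).+1 - ostat u (l i))).

(* Main.v *)
(** The p-values depend only on the relative order of the scores.  For an
  exchangeable vector without ties, averaging over the permutations of the
  coordinates shows that an event determined by the relative order has
  probability #{good permutations} / N!, whatever the law of the scores.
  On the other side, a spacing U_(l+1) - U_(l) is the Lebesgue measure of the
  set of v in [0, 1] with exactly l of the U_j below v, so that P_{n,m} is the
  law of such a relative-order event for n + m independent uniform variables,
  which are exchangeable without ties.  The two events differ by a reversal of
  the order, which does not change the number of good permutations. *)
Require Import Defs.
From HB Require Import structures.
From mathcomp Require Import all_boot all_order all_algebra all_fingroup.
From mathcomp Require Import all_classical all_reals all_analysis.
From mathcomp Require Import measurable_realfun.
Import Order.TTheory GRing.Theory Num.Theory.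
Local Open Scope classical_set_scope.
Local Open Scope ring_scope.
Set Implicit Arguments. Unset Strict Implicit. Unset Printing Implicit Defensive.

(** * Order patterns of exchangeable scores *)


(* Alias of ['I_N -> R] carrying the pointed structure required by
   [g_sigma_algebraType]. *)
Definition scores (R : realType) (N : nat) := 'I_N -> R.
HB.instance Definition _ R N := gen_eqMixin (scores R N).
HB.instance Definition _ R N := gen_choiceMixin (scores R N).
HB.instance Definition _ R N := isPointed.Build (scores R N) (fun=> 0).

Definition borel_scores (R : realType) (N : nat) : measurableType _ :=
  g_sigma_algebraType (@rectangles R N : set (set (scores R N))).

Lemma measurable_score (R : realType) (N : nat) (j : 'I_N) :
  measurable_fun setT (fun x : borel_scores R N => x j).
Proof.
move=> _ B mB; rewrite setTI; apply: sub_sigma_algebra.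
exists (fun k => if k == j then B else setT); split => [k|]; first by case: ifP.
apply/seteqP; split => [x /= Bx k|x /= /(_ j)]; last by rewrite eqxx.
by case: eqP => [->|].
Qed.

Lemma measurable_fun_scores (d : measure_display) (T : measurableType d)
    (R : realType) (N : nat) (X : 'I_N -> T -> R) :
  (forall j, measurable_fun setT (X j)) ->
  measurable_fun setT (fun t => (X ^~ t) : borel_scores R N).
Proof.
move=> mX.
have := @measurability _ _ T (borel_scores R N) setT (fun t => X ^~ t)
  (@rectangles R N) erefl; apply => //.
move=> _ [_ [B [mB ->]] <-]; rewrite setTI.
rewrite (_ : _ @^-1` _ = \bigcap_(j in setT) (X j @^-1` B j)).
  apply: fin_bigcap_measurable => // j _.
  by rewrite -[X in measurable X]setTI; exact: mX.
by apply/seteqP; split => [t /= Bt j _|t /= Bt j]; exact: Bt.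
Qed.

(** A finite type of comparison tables, so that an event determined by the relative order is a
    boolean predicate [h] on finitely many values. *)
Definition cmp (R : realType) (N : nat) (x : 'I_N -> R) : {ffun 'I_N * 'I_N -> bool} :=
  [ffun p => x p.1 <= x p.2].

(** The permutation [s] is read here as a vector of ranks. *)
Definition perm_fraction (N : nat) (R : realType)
    (h : {ffun 'I_N * 'I_N -> bool} -> bool) : R :=
  #|[pred s : 'S_N | h [ffun p => (s p.1 <= s p.2)%N]]|%:R / N`!%:R.

Lemma measurable_cmp (d : measure_display) (T : measurableType d) (R : realType) (N : nat)
  (X : 'I_N -> T -> R) (h : {ffun 'I_N * 'I_N -> bool} -> bool) :
  (forall j, measurable_fun setT (X j)) ->
  measurable [set t | h (cmp (X ^~ t))].
Proof.
move=> mX.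
have -> : [set t | h (cmp (X ^~ t))] =
  \bigcup_(M in [set M | h M]) \bigcap_(p in [set: 'I_N * 'I_N])
     [set t | (X p.1 t <= X p.2 t) = M p].
  apply/seteqP; split => [t /= ht|t /= [M hM /= Mt]].
    by exists (cmp (X ^~ t)) => // p _ /=; rewrite ffunE.
  suff -> : cmp (X ^~ t) = M by [].
  by apply/ffunP => p; rewrite ffunE Mt.
apply: fin_bigcup_measurable => // M _.
apply: fin_bigcap_measurable => // p _.
have := measurable_fun_ler (mX p.1) (mX p.2).
by move=> /(_ measurableT [set M p] I); rewrite setTI.
Qed.

Lemma rank_perm (R : realType) (N : nat) (x : 'I_N -> R) : injective x ->
  exists r : 'S_N, forall i j, (x i <= x j) = (r i <= r j)%N.
Proof.
move=> xI.
pose rk i := #|[pred j | x j < x i]|.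
have rkN i : (rk i < N)%N.
  rewrite -[X in (_ < X)%N]card_ord; apply: proper_card.
  by apply/properP; split; [exact: fintype.subset_predT|exists i; rewrite ?inE ?ltxx].
have lt_rk i j : x i < x j -> (rk i < rk j)%N.
  move=> xij; apply: proper_card; apply/properP; split.
    by apply/fintype.subsetP => k; rewrite !inE => /lt_trans; apply.
  by exists i; rewrite ?inE ?ltxx.
have rkE i j : (x i <= x j) = (rk i <= rk j)%N.
  case: (ltgtP (x i) (x j)) => [/lt_rk/ltnW ->//|/lt_rk|/xI ->].
    by rewrite ltnNge => /negbTE.
  by rewrite leqnn.
pose f i := Ordinal (rkN i).
have fI : injective f.
  by move=> i j [] e; apply: xI; apply/le_anti; rewrite !rkE e leqnn.
by exists (perm fI) => i j; rewrite !permE /= rkE.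
Qed.

(** With [r] the ranks of [x], the table of [x \o s] is that of [s * r], and right multiplication by
    [r] is a bijection of ['S_N]. *)
Lemma card_perm_cmp (R : realType) (N : nat) (x : 'I_N -> R) 
  (h : {ffun 'I_N * 'I_N -> bool} -> bool) : injective x ->
  #|[pred s : 'S_N | h (cmp (x \o s))]| = 
  #|[pred s : 'S_N | h [ffun p => (s p.1 <= s p.2)%N]]|.
Proof.
move=> /rank_perm[r rE].
rewrite -!sum1_card [RHS](reindex_inj (@mulIg _ r)) /=.
apply: eq_bigl => s; rewrite !inE; congr h.
by apply/ffunP => p; rewrite !ffunE /= rE !permM.
Qed.

(** By exchangeability the [N!] events [E s] all have the probability sought, while at an outcome
    without ties exactly [c] of them hold. Integrating the sum of their indicators yields [c]. *)
Lemma exchangeable_cmp (d : measure_display) (T : measurableType d)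
  (R : realType) (P : probability T R) (N : nat) (S : 'I_N -> T -> R)
  (h : {ffun 'I_N * 'I_N -> bool} -> bool) :
  (forall j, measurable_fun setT (S j)) -> exchangeable P S -> no_ties_as P S ->
  P [set t | h (cmp (S ^~ t))] = (perm_fraction R h)%:E.
Proof.
move=> mS eS nS.
pose E (s : 'S_N) := [set t | h (cmp (fun j => S (s j) t))].
have mE s : measurable (E s) by apply: measurable_cmp => j; exact: mS.
(* Measurability of the coordinates of [borel_scores] makes the pattern event a set to which
   exchangeability applies. *)
have hB : borel_prod [set x : 'I_N -> R | h (cmp x)].
  exact: (measurable_cmp h (@measurable_score R N)).
have PE s : P (E s) = P [set t | h (cmp (S ^~ t))] by rewrite /E (eS s _ hB).
pose c := #|[pred s : 'S_N | h [ffun p => (s p.1 <= s p.2)%N]]|.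
have sumE : (\sum_(s : 'S_N) P (E s) = c%:R%:E)%E.
  under eq_bigr do rewrite -[E _]setIT -integral_indic//.
  rewrite -ge0_integral_sum//; last first.
    by move=> s; exact/measurable_EFinP/measurable_indic.
  transitivity (\int[P]_t (cst c%:R%:E) t)%E.
    apply: ae_eq_integral => //.
      by apply: emeasurable_sum => s; exact/measurable_EFinP/measurable_indic.
    apply: filterS nS => t tI _ /=.
    rewrite sumEFin /c -(card_perm_cmp h tI) -sum1_card natr_sum.
    rewrite [in RHS]big_mkcond /=; congr EFin.
    apply: eq_bigr => s _; rewrite indicE inE.
    have -> : (t \in E s) = h (cmp ((S ^~ t) \o s)) by apply/idP/idP; rewrite inE.
    by case: (h _).
  by rewrite integral_cst//= probability_setT mule1.
move: sumE; under eq_bigr do rewrite PE.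
have Pfin : P [set t | h (cmp (S ^~ t))] \is a fin_num.
  by apply: fin_num_measure; apply: measurable_cmp.
rewrite -(fineK Pfin) sumEFin sumr_const card_Sn -[_ *+ N`!]mulr_natr => -[xE].
by congr EFin; rewrite /perm_fraction -/c -xE mulfK// pnatr_eq0 -lt0n fact_gt0.
Qed.

(** * Independent uniform variables *)

Section cube.
Context {R : realType}.

Local Notation RR := (measurableTypeR R).
Let unif : probability _ R := @uniform_prob R 0 1 ltr01.

Definition tuple_cons (k : nat) (p : RR * k.-tuple RR) : k.+1.-tuple RR :=
  [tuple of p.1 :: p.2].

Let measurable_tuple_cons k : measurable_fun setT (@tuple_cons k).
Proof. exact: measurable_cons. Qed.

HB.instance Definition _ k :=
  isMeasurableFun.Build _ _ _ _ (@tuple_cons k) (@measurable_tuple_cons k).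

(** The law of [k] independent uniforms, built head first to match the recursion of
    [iid_unif_expect]. *)
Fixpoint cube (k : nat) : probability (k.-tuple RR) R :=
  match k with
  | 0 => \d_[tuple]
  | k'.+1 => distribution (unif \x cube k')%E (@tuple_cons k')
  end.

Lemma iid_unif_expect_cube k (h : seq R -> bool) :
  measurable [set t : k.-tuple RR | h t] ->
  iid_unif_expect k (fun s => (h s)%:R) = cube k [set t : k.-tuple RR | h t].
Proof.
elim: k h => [|k IH] h mh.
  rewrite /= diracE; case: (boolP (h [::])) => h0; first by rewrite mem_set.
  by rewrite memNset //; exact/negP.
pose A := @tuple_cons k @^-1` [set t | h t].
have mA : measurable A by rewrite -[A]setTI; exact: measurable_tuple_cons.
have xA x : xsection A x = [set t | h (x :: t)].
  by apply/seteqP; split => t; rewrite /xsection /= inE.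
(* The product measure is by definition the integral of the measures of the sections. *)
rewrite /= [RHS](_ : _ = \int[unif]_x cube k (xsection A x))%E//.
rewrite /unif integral_uniform//; last exact: measurable_fun_xsection.
rewrite subr0 invr1 mul1e; apply: eq_integral => x _.
rewrite IH ?xA//.
by rewrite -xA; exact: measurable_xsection.
Qed.

Lemma cube_rectangle k (B : 'I_k -> set R) : (forall j, measurable (B j)) ->
  cube k [set t | forall j, B j (tnth t j)] = (\prod_(j < k) unif (B j))%E.
Proof.
elim: k B => [|k IH] B mB.
  rewrite big_ord0 /= diracE mem_set// => -[].
  by case.
have mBk : measurable [set t : k.-tuple RR | forall j, B (lift ord0 j) (tnth t j)].
  rewrite (_ : [set t | _] = \bigcap_(j in setT) ((@tnth k RR ^~ j) @^-1` B (lift ord0 j))).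
    apply: fin_bigcap_measurable => // j _.
    by rewrite -[X in measurable X]setTI; apply: measurable_tnth => //; exact: mB.
  by apply/seteqP; split => [t /= Bt j _|t /= Bt j]; exact: Bt.
rewrite big_ord_recl -IH// -product_measure1E//; last exact: mB.
rewrite [LHS]/=/distribution /pushforward.
apply: (congr1 (unif \x cube k)%E).
apply/seteqP; split => [[x t] /= Bt|[x t] /= [Bx Bt] j].
  split; first exact: (Bt ord0).
  by move=> j; have := Bt (lift ord0 j); rewrite tnthS.
by case: (unliftP ord0 j) => [i ->|->] //; rewrite tnthS.
Qed.

Lemma measurable_tuple_nth k (j : 'I_k) :
  measurable_fun setT (fun t : k.-tuple RR => tnth t j : R).
Proof. exact: (@measurable_tnth _ RR). Qed.

(** Both laws give a rectangle the same product of side measures, and rectangles form a generating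
    class closed under intersection, so uniqueness of measures applies. *)
Lemma cube_exchangeable k :
  exchangeable (cube k) (fun j (t : k.-tuple RR) => tnth t j : R).
Proof.
move=> s A bA.
pose f (s : 'S_k) (t : k.-tuple RR) : borel_scores R k := fun j => tnth t (s j).
have mf s' : measurable_fun setT (f s').
  by apply: measurable_fun_scores => j; exact: measurable_tuple_nth.
pose X s' : {mfun k.-tuple RR >-> borel_scores R k} :=
  HB.pack (f s') (isMeasurableFun.Build _ _ _ _ _ (mf s')).
have XE (s' : 'S_k) B : (forall j, measurable (B j)) ->
    cube k [set t | forall j, B j (tnth t (s' j))] = (\prod_(j < k) unif (B j))%E.
  (* Permuting the coordinates by [s'] amounts to permuting the sides by its inverse. *)
  move=> mB; rewrite (reindex_inj (@perm_inj _ s'^-1%g)) -cube_rectangle;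
    last by move=> j; exact: mB.
  congr (cube k _); apply/seteqP; split => t /= Bt j.
    by have := Bt (s'^-1%g j); rewrite permKV.
  by have := Bt (s' j); rewrite permK.
transitivity (distribution (cube k) (X 1%g) A); last first.
  suff f1 t : f 1%g t = tnth t by congr (cube k _); apply/seteqP; split => t /=; rewrite f1.
  by apply/funext => j; rewrite /f perm1.
apply: (@measure_unique _ R (borel_scores R k) (@rectangles R k) (fun=> setT)
  erefl _ _ _ (distribution (cube k) (X s)) (distribution (cube k) (X 1%g))) => //.
- move=> _ _ [B [mB ->]] [C [mC ->]]; exists (fun j => B j `&` C j); split.
    by move=> j; exact: measurableI.
  by apply/seteqP; split => x /= => [[Bx Cx] j|BCx]; split=> // j; have [] := BCx j.
- by move=> _; exists (fun=> setT); split => //; apply/seteqP; split.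
- by rewrite bigcup_const.
- by move=> _ [B [mB ->]]; rewrite [LHS]XE// [RHS]XE.
- move=> _; apply: (le_lt_trans _ (ltry 1)).
  exact: (probability_le1 (distribution (cube k) (X s)) measurableT).
Qed.

Lemma unif_finite (s : seq R) : unif [set x | x \in s] = 0%E.
Proof.
have cs : countable [set x | x \in s] by apply/finite_set_countable/finite_seqP; exists s.
have /null_content_dominatesP := @dominates_uniform_prob R 0 1 ltr01; apply.
  exact: countable_measurable.
exact: countable_lebesgue_measure0.
Qed.

Lemma measurable_not_uniq n : measurable [set t : n.-tuple RR | ~~ uniq t].
Proof.
(* A repeated entry shows in the table as two distinct indices, each compared as at most the
   other. *)
pose h (M : {ffun 'I_n * 'I_n -> bool}) :=
  ~~ [forall i, forall j, (M (i, j) && M (j, i)) ==> (i == j)].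
rewrite (_ : [set t | _] = [set t | h (cmp (tnth t : 'I_n -> R))]).
  by apply: measurable_cmp => j; exact: measurable_tuple_nth.
apply/seteqP; split => t /=; apply: contra.
  move=> /'forall_'forall_implyP ht; apply/tuple_uniqP => i j tij.
  by apply/eqP/ht; rewrite !ffunE /= tij lexx.
move=> /tuple_uniqP tI; apply/'forall_'forall_implyP => i j.
by rewrite !ffunE /= => /le_anti/tI ->.
Qed.

(** Almost surely the tail has no repetition; the head then creates one only by falling into the
    finite set of tail entries, which is null for the uniform law. *)
Lemma cube_not_uniq k : cube k [set t : k.-tuple RR | ~~ uniq t] = 0%E.
Proof.
have mU := measurable_not_uniq.
elim: k => [|k IH].
  rewrite (_ : [set t | _] = set0) ?measure0//.
  by apply/seteqP; split => t //=; rewrite tuple0.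
pose A := @tuple_cons k @^-1` [set t | ~~ uniq t].
have mA : measurable A by rewrite -[A]setTI; apply: measurable_tuple_cons => //; exact: mU.
transitivity ((unif \x cube k)%E A) => //.
(* The tail must be the outer variable here, so the product measure is replaced by the one that
   integrates over sections in the other order. *)
rewrite (@product_measure_unique _ _ _ _ _ _ _ (unif \x^ cube k)%E)//; last first.
  by move=> B C mB mC; exact: product_measure2E.
transitivity (\int[cube k]_t (cst 0%E) t)%E; last by rewrite integral0.
apply: ae_eq_integral => //.
  exact: measurable_fun_ysection.
exists [set t : k.-tuple RR | ~~ uniq t]; split; [exact: mU|exact: IH|move=> t /=].
apply: contra_notN => ut _ /=.
rewrite (_ : ysection A t = [set x | x \in val t]); first exact: unif_finite.
by apply/seteqP; split => x; rewrite /ysection /= inE /A /= ut andbT negbK.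
Qed.

Lemma cube_no_ties k :
  no_ties_as (cube k) (fun j (t : k.-tuple RR) => tnth t j : R).
Proof.
exists [set t : k.-tuple RR | ~~ uniq t]; split.
- exact: measurable_not_uniq.
- exact: cube_not_uniq.
- by move=> t /=; apply: contra_notN => /tuple_uniqP.
Qed.

End cube.

(** * Spacings of order statistics *)

(** Splits the first [n] variables from the last [m]. The inner formula is asked on the unit cube,
    over which the outer integrals run. *)
Lemma iid_unif_expect_cat (R : realType) (n m : nat) (H K : seq R -> R) :
  (forall u, size u = n -> all (fun x : R => 0 <= x <= 1) u ->
     iid_unif_expect m (fun v => H (u ++ v)) = (K u)%:E) ->
  iid_unif_expect (n + m) H = iid_unif_expect n K.
Proof.
elim: n H K => [|n IH] H K HK; first exact: (HK [::]).
apply: eq_integral => x; rewrite inE /= in_itv /= => x01.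
by apply: IH => u su u01; apply: (HK (x :: u)); rewrite /= ?su ?x01.
Qed.

(** The constant [c] serves the induction: the factor of the first coordinate, once that coordinate
    is fixed, is absorbed into it. *)
Lemma iid_unif_expect_prod (R : realType) (m : nat) (f : 'I_m -> R -> R)
    (a : 'I_m -> R) (c : R) : 0 <= c ->
  (forall i, measurable_fun (`[0, 1]%classic : set R) (f i)) -> (forall i x, 0 <= f i x) ->
  (forall i, \int[lebesgue_measure]_(x in `[0%R, 1%R]) (f i x)%:E = (a i)%:E)%E ->
  iid_unif_expect m (fun v => c * \prod_(i < m) f i (nth 0 v i)) =
  (c * \prod_(i < m) a i)%:E.
Proof.
move=> c0 mf f0 fa.
have a0 i : 0 <= a i.
  by rewrite -lee_fin -fa; apply: integral_ge0 => x _; rewrite lee_fin.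
elim: m f a c c0 mf f0 fa a0 => [|m IH] f a c c0 mf f0 fa a0.
  by rewrite /= !big_ord0.
rewrite /=; under eq_integral.
  move=> x _; under [F in iid_unif_expect _ F]eq_fun do rewrite big_ord_recl /= mulrA.
  rewrite (IH (fun i => f (lift ord0 i)) (fun i => a (lift ord0 i)))//;
    last by rewrite mulr_ge0.
  rewrite -mulrA mulrCA mulrC EFinM.
  over.
rewrite ge0_integralZl//; last 3 first.
- by apply/measurable_EFinP; exact: mf.
- by move=> x _; rewrite lee_fin.
- by rewrite lee_fin mulr_ge0// prodr_ge0.
by rewrite fa big_ord_recl -EFinM -mulrA [X in c * X]mulrC.
Qed.

(** In a sorted list the entries at most [v] form a prefix, whose length is the count. *)
Lemma sorted_count_le (R : realType) (s : seq R) (v : R) (i : nat) :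
  sorted <=%R s -> (i < size s)%N ->
  (nth 0 s i <= v) = (i < count (fun x => (x <= v)%R) s)%N.
Proof.
elim: s i => // x s IH i xs; have ss := path_sorted xs.
have xall : all (<=%R x) s by apply: order_path_min xs; exact: le_trans.
have [xv|vx] := leP x v.
  by case: i => [|i] /=; rewrite xv //= add1n !ltnS => /IH->.
have xvF : (x <= v) = false by rewrite leNgt vx.
rewrite [count _ _]/= xvF add0n => si.
rewrite (_ : count _ _ = 0%N); last first.
  apply/eqP; rewrite -leqn0 leqNgt -has_count -all_predC; apply: sub_all xall => y /= xy.
  by rewrite -ltNge (lt_le_trans vx).
rewrite ltn0; apply/negbTE; rewrite -ltNge; case: i si => [|i] //=; rewrite ltnS => si.
by rewrite (lt_le_trans vx)//; apply/(all_nthP 0): si.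
Qed.

(** The interval is closed on the left and open on the right, except for [l = size u]: its right end
    is then the conventional [1], which [v] may attain, and it is closed. *)
Lemma spacing_count (R : realType) (u : seq R) (l : nat) (v : R) :
  all (fun x : R => 0 <= x <= 1) u -> (l <= size u)%N -> 0 <= v <= 1 ->
  (count (fun x => (x <= v)%R) u == l) =
  (v \in Interval (BLeft (ostat u l)) (BSide (l < size u)%N (ostat u l.+1))).
Proof.
move=> u01 lu /andP[v0 v1]; set s := sort <=%R u.
have ss : sorted <=%R s by exact: sort_le_sorted.
have szs : size s = size u by rewrite size_sort.
rewrite (_ : count _ u = count (fun x => (x <= v)%R) s); last by rewrite count_sort.
rewrite itv_boundlr /= !bnd_simp.
have nthl : (ostat u l <= v) = (l <= count (fun x => (x <= v)%R) s)%N.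
  rewrite /ostat; case: l lu => [|l] lu /=; first by rewrite v0.
  by rewrite nth_rcons szs lu sorted_count_le// szs.
rewrite nthl eqn_leq andbC; congr (_ && _).
have [ls|sl] := ltnP l (size u).
  by rewrite /ostat /= nth_rcons szs ls /= bnd_simp ltNge sorted_count_le ?szs// ltnNge negbK.
have <- : size u = l by apply/eqP; rewrite eqn_leq lu sl.
by rewrite /ostat /= nth_rcons szs ltnn eqxx /= bnd_simp v1 -szs count_size.
Qed.

Lemma ostat_le (R : realType) (u : seq R) (k : nat) :
  all (fun x : R => 0 <= x <= 1) u -> (k <= size u)%N -> ostat u k <= ostat u k.+1.
Proof.
move=> u01 ku; set s := sort <=%R u.
have s01 : all (fun x : R => 0 <= x <= 1) s by rewrite all_sort.
have w : sorted <=%R (0 :: rcons s 1).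
  rewrite /= rcons_path (path_sortedE le_trans) sort_le_sorted andbT; apply/andP; split.
    by apply: sub_all s01 => x /andP[].
  by have := mem_last 0 s; rewrite inE => /orP[/eqP->//|/(allP s01)/andP[]].
by rewrite /ostat (sorted_leq_nth le_trans lexx) // ?inE /= size_rcons size_sort ltnS // ltnW.
Qed.

Lemma ostat_itv (R : realType) (u : seq R) (k : nat) :
  all (fun x : R => 0 <= x <= 1) u -> 0 <= ostat u k <= 1.
Proof.
move=> u01; rewrite /ostat; have [kw|wk] := ltnP k (size (0 :: rcons (sort <=%R u) 1)).
  have := mem_nth 0 kw; rewrite inE mem_rcons inE mem_sort.
  by move=> /or3P[/eqP->|/eqP->|/(allP u01)//]; rewrite ?lexx ?ler01.
(* Past the last index [nth] returns its default [0], which still lies in [[0, 1]]. *)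
by rewrite nth_default// lexx ler01.
Qed.

Lemma integral_spacing (R : realType) (u : seq R) (l : nat) :
  all (fun x : R => 0 <= x <= 1) u -> (l <= size u)%N ->
  let f v : R := (count (fun x => (x <= v)%R) u == l)%:R in
  measurable_fun (`[0, 1]%classic : set R) f /\
  (\int[lebesgue_measure]_(v in `[0%R, 1%R]) (f v)%:E =
   (ostat u l.+1 - ostat u l)%:E)%E.
Proof.
move=> u01 lu f.
set I := Interval (BLeft (ostat u l)) (BSide (l < size u)%N (ostat u l.+1)).
have fE : {in `[0, 1]%classic, f =1 \1_[set` I]}.
  move=> v; rewrite inE /= in_itv /= => v01.
  by rewrite /f (spacing_count u01 lu v01) indicE; congr (_%:R); rewrite mem_setE.
split.
  apply: (eq_measurable_fun (\1_[set` I] : R -> R)); first by move=> v /fE ->.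
  exact/measurable_funTS/measurable_indic.
under eq_integral => v v01 do rewrite fE//.
rewrite integral_indic// setIidl; last first.
  move=> v /=; rewrite itv_boundlr in_itv /= !bnd_simp => /andP[lv vl].
  have /andP[l0 _] := ostat_itv l u01; have /andP[_ l1] := ostat_itv l.+1 u01.
  rewrite (le_trans l0 lv) (le_trans _ l1)//.
  by move: vl; case: ltnP => _; rewrite bnd_simp // => /ltW.
(* The measure of an interval is its length if the ends are strictly ordered and [0] otherwise; in
   the second case the ends coincide. *)
rewrite [LHS]lebesgue_measure_itv /= lte_fin; case: ltP => // ba.
have -> : ostat u l.+1 = ostat u l by apply/le_anti; rewrite ba ostat_le.
by rewrite subrr.
Qed.

(** * Rank patterns *)

Definition rank_pattern (n m : nat) (l : 'I_m -> 'I_n.+1)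
    (M : {ffun 'I_(n + m) * 'I_(n + m) -> bool}) : bool :=
  [forall i : 'I_m, #|[pred j : 'I_n | M (rshift n i, lshift m j)]| == l i].

(** Transposing a comparison table amounts to reversing the order. *)
Definition flip (N : nat) (M : {ffun 'I_N * 'I_N -> bool}) :
  {ffun 'I_N * 'I_N -> bool} := [ffun p => M (p.2, p.1)].

(** Following [s] by [rev_ord] transposes its table, and this is a bijection of ['S_N]. *)
Lemma perm_fraction_flip (R : realType) (N : nat)
    (h : {ffun 'I_N * 'I_N -> bool} -> bool) :
  perm_fraction R (h \o @flip N) = perm_fraction R h.
Proof.
rewrite /perm_fraction; congr (_%:R / _).
rewrite -!sum1_card [RHS](reindex_inj (@mulIg _ (perm (@rev_ord_inj N)))) /=.
apply: eq_bigl => s; rewrite !inE; congr h.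
by apply/ffunP => p; rewrite !ffunE !permM !permE /= leq_sub2lE.
Qed.

Lemma conformal_pvalueE (R : realType) (n m : nat) (x : 'I_(n + m) -> R)
    (l : 'I_m -> 'I_n.+1) :
  (forall i, conformal_pvalue x i = (l i).+1%:R / n.+1%:R) <->
  rank_pattern l (cmp x).
Proof.
have xE i : #|[set j : 'I_n | x (rshift n i) <= x (lshift m j)]| =
            #|[pred j : 'I_n | cmp x (rshift n i, lshift m j)]|.
  by apply: eq_card => j; rewrite !inE ffunE /=; apply/idP/idP; rewrite inE.
have n0 : n.+1%:R != 0 :> R by rewrite pnatr_eq0.
split=> [H|/forallP H i].
  apply/forallP => i; have := H i; rewrite /conformal_pvalue xE => /(mulIf (invr_neq0 n0)).
  by move=> /eqP; rewrite eqr_nat add1n eqSS.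
by rewrite /conformal_pvalue xE (eqP (H i)) add1n.
Qed.

Lemma prod_natr_bool (R : realType) (m : nat) (b : 'I_m -> bool) :
  \prod_(i < m) (b i)%:R = [forall i, b i]%:R :> R.
Proof.
have [/forallP bT|/forallPn[i /negbTE bi]] := boolP [forall i, b i].
  by rewrite big1// => i _; rewrite bT.
by rewrite (bigD1 i)//= bi mul0r.
Qed.

(** For fixed [u], the product of spacings is an expectation over [m] further uniforms, each spacing
    being the integral of an indicator. The [flip] enters because p-values count calibration scores
    at or above the test score, whereas spacings count those at or below it. *)
Lemma Pnm_pmf_rank_pattern (R : realType) (n m : nat) (l : 'I_m -> 'I_n.+1) :
  Pnm_pmf R l = iid_unif_expect (n + m)
    (fun s : seq R => ((rank_pattern l \o @flip _) (cmp (fun j => nth 0 s j)))%:R).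
Proof.
symmetry; apply: iid_unif_expect_cat => u su u01.
pose f i v : R := (count (fun x => x <= v) u == l i)%:R.
have lu i : (l i <= size u)%N by rewrite su -ltnS.
rewrite -[X in _ = X%:E]mul1r -(@iid_unif_expect_prod R m f)//; last 2 first.
- by move=> i; have [] := integral_spacing u01 (lu i).
- by move=> i; have [] := integral_spacing u01 (lu i).
congr iid_unif_expect; apply/funext => v.
rewrite mul1r prod_natr_bool; congr (_%:R); congr (nat_of_bool _).
apply: eq_forallb => i; congr (_ == _).
rewrite -sum1_card -sum1_count (big_nth 0) su big_mkord; apply: eq_bigl => j.
(* In [u ++ v] the index [lshift m j] reads [u] and [rshift n i] reads [v]. *)
by rewrite !inE !ffunE /= !nth_cat su ltn_ord ltnNge leq_addr /= addKn.
Qed.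

(** Every p-value is some [k.+1 / n.+1] with [k <= n], so these point probabilities determine the
    joint law; the right side involves neither [P] nor [S]. *)
Theorem proposition2 (d : measure_display) (T : measurableType d)
  (R : realType) (P : probability T R) (n m : nat) (hn : (0 < n)%N) (hm : (0 < m)%N)
  (S : 'I_(n + m) -> T -> R)
  (S_meas : forall j, measurable_fun setT (S j))
  (S_exch : exchangeable P S) (S_noties : no_ties_as P S) :
  forall l : 'I_m -> 'I_n.+1,
    P [set t | forall i : 'I_m,
         conformal_pvalue (fun j => S j t) i = (l i).+1%:R / (n.+1)%:R]
    = Pnm_pmf R l.
Proof.
move=> l.
have -> : [set t | forall i, conformal_pvalue (S ^~ t) i = (l i).+1%:R / n.+1%:R] =
          [set t | rank_pattern l (cmp (S ^~ t))].
  by apply/seteqP; split => t /= /conformal_pvalueE.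
rewrite exchangeable_cmp// -perm_fraction_flip.
have mt j := @measurable_tuple_nth R (n + m) j.
(* The fraction of permutations is turned back into a probability, now for [n + m] independent
   uniform scores. *)
rewrite -(exchangeable_cmp _ mt (@cube_exchangeable R _) (@cube_no_ties R _)).
have tE (t : (n + m).-tuple (measurableTypeR R)) :
  (fun j : 'I_(n + m) => tnth t j) = (fun j => nth 0 t j) :> ('I_(n + m) -> R).
  by apply/funext => j; rewrite (tnth_nth 0).
rewrite Pnm_pmf_rank_pattern iid_unif_expect_cube; last first.
  by under eq_set do rewrite -tE; exact: (measurable_cmp _ mt).
by congr (cube _ _); apply/seteqP; split => t /=; rewrite tE.
Qed.
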